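(* Let $(X,\rho)$ be a metric space and let $\alpha\ge 0$ be a real number. The following statements are equivalent: (1) $\dim_{ML}X>\alpha$; (2) there are integers $k,l\ge 2$ with $\frac{\log l}{k\log 2}>\alpha$ such that $X$ contains a strongly $(k,l)$-regular set.
   Context: Subsets of a metric space are regarded as metric spaces with the inherited metric. For a metric space $(X,\rho)$, $B(x,r)=\{y\in X:\rho(x,y)\le r\}$ denotes the closed ball in $X$, and $N_r(A)\in\{0,1,2,\dots\}\cup\{\infty\}$ denotes the minimal number of sets of diameter at most $r$ required to cover $A\subset X$. The lower dimension of a metric space $X$ with at least two points is $$\dim_L X=\sup\Big\{\alpha\in\mathbb{R}:\ \exists\, C>0 \text{ such that for all real } 0<r<R\le\operatorname{diam}X \text{ and all } x\in X,\ N_r(B(x,R))\ge C\left(\tfrac{R}{r}\right)^{\alpha}\Big\}\in[0,\infty],$$ where $\operatorname{diam}X$ may be $\infty$. Conventions: $\dim_L\emptyset=0$, and $\dim_L X=0$ if $X$ is a one-point space. The modified lower dimension of a metric space $X$ is $\dim_{ML}X=\sup\{\dim_L E: E\subset X\}$. Sequences: $\mathbb{N}=\{0,1,2,\dots\}$; a natural number $l$ is identified with $\{0,1,\dots,l-1\}$; $l^n$ is the set of functions from $n$ into $l$ (sequences of length $n$ with entries in $\{0,\dots,l-1\}$), so $l^0=\{\emptyset\}$; $l^{<\omega}=\bigcup_{n\in\mathbb{N}}l^n$; $s^\frown t$ denotes the concatenation of $s$ and $t$, and $s^\frown 0$ is $s$ followed by the entry $0$. Let $k,l\ge 2$ be integers.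 A family $\{y_s\}_{s\in l^{<\omega}}$ of points of $X$ is a $(k,l)$-regular set if for all $n\in\mathbb{N}$: (i) $\rho(y_s,y_t)\le 2^{-kn-1}$ whenever $s\in l^n$, $t\in l^{n+1}$ and $t$ extends $s$; (ii) $\rho(y_s,y_t)\ge 2^{-kn+2}$ whenever $s,t\in l^n$ and $s\ne t$. It is a strongly $(k,l)$-regular set if in addition (iii) $y_{s^\frown 0}=y_s$ for all $s\in l^{<\omega}$. *)

(* Defs.v *)
From HB Require Import structures.
From mathcomp Require Import all_boot all_order all_algebra.
From mathcomp Require Import all_classical all_reals all_analysis.

Set Implicit Arguments.
Unset Strict Implicit.
Unset Printing Implicit Defensive.

Import Order.TTheory GRing.Theory Num.Theory.

Local Open Scope classical_set_scope.
Local Open Scope ring_scope.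

(* The library equips a subset of a pseudometric space with the inherited
   pseudometric; this extends that instance to metric spaces. *)
Section inherited_metric.
Context {R : realType} {X : metricType R} (A : set X).

Definition sub_mdist (x y : set_type A) : R := mdist (set_val x) (set_val y).

Lemma sub_mdist_ge0 x y : 0 <= sub_mdist x y.
Proof. exact: mdist_ge0. Qed.

Lemma sub_mdist_positivity x y : sub_mdist x y = 0 -> x = y.
Proof. by move=> /mdist_positivity/val_inj. Qed.

Lemma sub_ballEmdist (x : set_type A) (d : R) :
  ball x d = [set y | sub_mdist x y < d].
Proof.
by rewrite -initial_ballE ballEmdist.
Qed.

HB.instance Definition _ := PseudoMetric_isMetric.Build R (set_type A)
  sub_mdist_ge0 sub_mdist_positivity sub_ballEmdist.

End inherited_metric.

Section dimensions.
Context {R : realType}.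

(* The library's closed_ball is the closure of the open ball, which may be
   smaller than this set. *)
Definition cball (X : metricType R) (x : X) (r : R) : set X :=
  [set y | mdist x y <= r].

(* The maximum with 0 only matters for A = set0. *)
Definition diam (X : metricType R) (A : set X) : \bar R :=
  maxe 0%E (ereal_sup [set (mdist p.1 p.2)%:E | p in A `*` A]).

(* N_r(A); the infimum of the empty set is +oo. *)
Definition covering_number (X : metricType R) (r : R) (A : set X) : \bar R :=
  ereal_inf [set (n%:R)%:E | n in [set n : nat |
    exists U : 'I_n -> set X,
      (forall i, (diam (U i) <= r%:E)%E) /\ A `<=` \bigcup_i U i]].

Definition lower_exponent (X : metricType R) (a : R) : Prop :=
  exists2 C : R, 0 < C &
    forall r s : R, 0 < r -> r < s -> (s%:E <= diam [set: X])%E ->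
    forall x : X, ((C * (s / r) `^ a)%:E <= covering_number r (cball x s))%E.

Definition lower_dim (X : metricType R) : \bar R :=
  if `[< exists x y : X, x <> y >]
  then ereal_sup [set a%:E | a in lower_exponent X]
  else 0%E.

Definition modified_lower_dim (X : metricType R) : \bar R :=
  ereal_sup [set lower_dim (set_type E) | E in [set: set X]].

(* Finite sequences with entries in {0, ..., l-1} are encoded as seq 'I_l; the
   entry 0 is the element of 'I_l of value 0, which exists as soon as l > 0. *)
Definition regular_set (X : metricType R) (k l : nat) (y : seq 'I_l -> X) :
    Prop :=
  forall n : nat,
    (forall s t : seq 'I_l, size s = n -> size t = n.+1 -> prefix s t ->
       mdist (y s) (y t) <= 2 ^ (- (k * n)%N%:Z - 1)) /\
    (forall s t : seq 'I_l, size s = n -> size t = n -> s <> t ->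
       2 ^ (- (k * n)%N%:Z + 2) <= mdist (y s) (y t)).

Definition strongly_regular_set (X : metricType R) (k l : nat)
    (y : seq 'I_l -> X) : Prop :=
  regular_set k y /\
  forall (s : seq 'I_l) (i : 'I_l), i = 0%N :> nat -> y (rcons s i) = y s.

End dimensions.

(* Main.v *)
Require Import Defs.
From mathcomp Require Import all_boot all_order all_algebra.
From mathcomp Require Import all_classical all_reals all_analysis.
From mathcomp Require Import ring lra zify.

Set Implicit Arguments.
Unset Strict Implicit.
Unset Printing Implicit Defensive.

Import Order.TTheory GRing.Theory Num.Theory.

Local Open Scope classical_set_scope.
Local Open Scope ring_scope.

(* (1) => (2): if E has lower exponent beta > alpha, put b = 2^k. A ball of E of
   radius b^-n / 2 contains at least c b^beta points at mutual distance
   4 b^-(n+1), with c independent of n and k; for k large c b^beta exceeds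
   2 b^alpha, so a tree branching into l > b^alpha children can be grown
   greedily, each node being its own 0-th child.
   (2) => (1): take E = range y. If w has length n, all descendants of y_w stay
   within b^-n of it, and by (iii) every point of E descends from some node of
   each level. So a ball of radius 2 b^-n contains the l^j descendants at level
   n + j of one node, which are 4 b^-(n+j)-separated; this gives the exponent
   log l / (k log 2). *)

(** * Powers and scales *)

Section powers.
Context {R : realType}.

(** Bernoulli's inequality 1 + (a - 1) n <= a^n. *)
Lemma exp_unbounded (a c : R) : 1 < a ->
  exists K : nat, forall n, (K <= n)%N -> c < a ^+ n.
Proof.
move=> a1; exists (Num.bound (`|c| / (a - 1))) => n Kn.
have a10 : 0 < a - 1 by lra.
have bern m : 1 + (a - 1) * m%:R <= a ^+ m.
  elim: m => [|m IH]; first by rewrite mulr0 addr0 expr0.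
  rewrite exprS -natr1; have m0 : 0 <= m%:R :> R by [].
  have : a * (1 + (a - 1) * m%:R) <= a * a ^+ m.
    by rewrite ler_wpM2l //; lra.
  have := mulr_ge0 (mulr_ge0 (ltW a10) (ltW a10)) m0; nra.
have cn : `|c| / (a - 1) < n%:R.
  apply: (lt_le_trans (archi_boundP _)); last by rewrite ler_nat.
  by rewrite divr_ge0 // ltW.
rewrite ltr_pdivrMr // in cn.
by have := bern n; have := ler_norm c; lra.
Qed.

(** The least n with t <= b^n works: if n > 0, minimality gives b^(n-1) < t. *)
Lemma exp_bracket (b t : R) : 1 < b -> 0 < t ->
  exists n : nat, t <= b ^+ n /\ (n = 0%N \/ b ^+ n < b * t).
Proof.
move=> b1 t0; have [K HK] := exp_unbounded t b1.
have ex : exists n, t <= b ^+ n by exists K; exact: ltW (HK K (leqnn K)).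
case: (ex_minnP ex) => -[|n] tn min_n; first by exists 0%N; split => //; left.
exists n.+1; split => //; right; rewrite exprS ltr_pM2l ?(lt_trans ltr01) //.
by rewrite ltNge; apply/negP => /min_n; rewrite ltnn.
Qed.

Lemma expz2Nmuln (k n : nat) (i : int) :
  2 ^ (- (k * n)%N%:Z + i) = (2 ^+ k ^+ n)^-1 * 2 ^ i :> R.
Proof. by rewrite expfzDr // -exprnN exprM. Qed.

End powers.

(** * Covering numbers and separated points *)

Section covering.
Context {R : realType} {X : metricType R}.
Implicit Types (A : set X) (x : X) (r : R).

Lemma le_diam A x y : A x -> A y -> ((mdist x y)%:E <= diam A)%E.
Proof.
move=> Ax Ay; rewrite /diam le_max; apply/orP; right.
by apply: ereal_sup_ubound; exists (x, y).
Qed.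

Lemma diam_le A r : 0 <= r -> (forall x y, A x -> A y -> mdist x y <= r) ->
  (diam A <= r%:E)%E.
Proof.
move=> r0 Ar; rewrite /diam ge_max lee_fin r0 /=.
by apply: ge_ereal_sup => _ [[x y] [Ax Ay] <-]; rewrite lee_fin; exact: Ar.
Qed.

Lemma covering_number_subset A B r : A `<=` B ->
  (covering_number r A <= covering_number r B)%E.
Proof.
move=> AB; apply: le_ereal_inf => _ [n [U [dU BU]] <-].
by exists n => //; exists U; split => //; exact: subset_trans BU.
Qed.

(** Points more than r apart cannot share a set of diameter at most r, so sending each index to a
    covering set that contains its point is injective. *)
Lemma covering_number_separated A r (T : finType) (p : T -> X) :
  (forall i, A (p i)) -> (forall i j, i != j -> r < mdist (p i) (p j)) ->
  ((#|T|%:R)%:E <= covering_number r A)%E.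
Proof.
move=> Ap sep; apply: le_ereal_inf_tmp => _ [n [U [dU AU]] <-].
rewrite lee_fin ler_nat.
have /choice[f fP] : forall i, exists j, U j (p i).
  by move=> i; have [j _ Uj] := AU _ (Ap i); exists j.
rewrite -[leqRHS]card_ord; apply: (@leq_card _ _ f) => i j fij.
apply/eqP; apply: contraT => /sep; rewrite ltNge => /negP; case.
rewrite -lee_fin; apply: le_trans (dU (f i)).
by apply: le_diam; [|rewrite fij].
Qed.

(* Greedy choice: as long as fewer points than the covering number have been
   chosen, the open balls of radius r around them do not cover A. *)
Lemma separated_of_covering_number A r (l : nat) x : 0 <= r -> A x ->
  ((l%:R)%:E <= covering_number (2 * r) A)%E ->
  exists p : 'I_l -> X, [/\ forall i : 'I_l, i = 0%N :> nat -> p i = x,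
    forall i, A (p i) & forall i j, i != j -> r <= mdist (p i) (p j)].
Proof.
move=> r0 Ax lA.
have greedy j : (j < l)%N -> exists p : nat -> X, [/\ p 0%N = x,
    forall i, A (p i) &
    forall a b, (a < b)%N -> (b <= j)%N -> r <= mdist (p a) (p b)].
  elim: j => [_|j IH jl]; first by exists (fun=> x); split=> // a [].
  have [p [p0 Ap sep]] := IH (ltnW jl).
  have [z Az zp] : exists2 z, A z &
      forall i, (i <= j)%N -> r <= mdist (p i) z.
    apply: contrapT => nz.
    suff : (covering_number (2 * r) A <= (j.+1%:R)%:E)%E.
      by move/(le_trans lA); rewrite lee_fin ler_nat leqNgt jl.
    apply: ereal_inf_lbound; exists j.+1 => //.
    exists (fun i : 'I_j.+1 => [set z | mdist (p i) z < r]); split.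
      move=> i; apply: diam_le => [|y z /= yr zr]; first by lra.
      by have := metric_triangle y (p i) z; rewrite (metric_sym y (p i)); lra.
    move=> z Az; apply: contrapT => zU; apply: nz; exists z => // i ij.
    rewrite leNgt; apply/negP => iz; apply: zU.
    by exists (Ordinal (ij : (i < j.+1)%N)).
  exists (fun i => if i == j.+1 then z else p i); split => //.
    by move=> i; case: ifP.
  move=> a b ab bj; have -> : (a == j.+1) = false.
    by apply/negbTE; rewrite neq_ltn (leq_trans ab bj).
  case: (eqVneq b j.+1) ab bj => [-> aj _|bj ab bj1]; first exact: zp.
  by apply: sep => //; lia.
case: l => [|l] in lA greedy *; first by exists (fun=> x); split=> // -[].
have [p [p0 Ap sep]] := greedy l (ltnSn l).
exists (fun i => p i); split => // [i ->//|i j].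
rewrite neq_ltn => /orP[|] ij; first by apply: sep => //; rewrite -ltnS.
by rewrite metric_sym; apply: sep => //; rewrite -ltnS.
Qed.

End covering.

(** * Lower exponent of a strongly regular set *)

Lemma powR_exprn (R : realType) (a x : R) (m : nat) : 0 <= a ->
  (a ^+ m) `^ x = (a `^ x) ^+ m.
Proof.
by move=> a0; rewrite -!powR_mulrn ?powR_ge0 // -!powRrM mulrC.
Qed.

(** This is the exponent beta with b^beta = l for b = 2^k: one more level divides the scale by b and
    multiplies the number of nodes by l. *)
Lemma powR_ln_div (R : realType) (k l : nat) : (0 < k)%N -> (0 < l)%N ->
  (2 ^+ k) `^ (ln l%:R / (k%:R * ln 2)) = l%:R :> R.
Proof.
move=> k0 l0; have ln2 : ln 2 != 0 :> R by rewrite gt_eqF // ln_gt0 // ltr1n.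
have k0' : k%:R != 0 :> R by rewrite pnatr_eq0 -lt0n.
rewrite -powR_mulrn // -powRrM.
have -> : k%:R * (ln l%:R / (k%:R * ln 2)) = ln l%:R / ln 2 :> R.
  by field; rewrite k0' ln2.
by rewrite /powR pnatr_eq0 /= divfK // lnK // posrE ltr0n.
Qed.

Section regular_sets.
Context {R : realType} {X : metricType R} (k l : nat) (y : seq 'I_l -> X).

(** Induction along [u], with b = 2^k and n = [size s]: the first edge costs at most b^-n / 2 and
    the rest at most b^-(n+1), again at most b^-n / 2. *)
Lemma regular_set_mdist_le (s u : seq 'I_l) : (0 < k)%N -> regular_set k y ->
  mdist (y s) (y (s ++ u)) <= (2 ^+ k ^+ size s)^-1.
Proof.
move=> k0 reg; have b2 : 2 <= 2 ^+ k :> R.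
  by rewrite -[leLHS]expr1 ler_eXn2l // ltr1n.
elim: u s => [|i u IH] s; first by rewrite cats0 mdistxx invr_ge0 !exprn_ge0.
have := IH (rcons s i); rewrite cat_rcons size_rcons exprS.
have [/(_ s (rcons s i) erefl) + _] := reg (size s).
rewrite size_rcons -cats1 prefix_prefix => /(_ erefl isT).
rewrite expz2Nmuln exprN1 invfM.
have b0 : 0 < (2 ^+ k ^+ size s)^-1 :> R by rewrite invr_gt0 !exprn_gt0.
have b1 : (2 ^+ k)^-1 <= 2^-1 :> R by rewrite lef_pV2 ?posrE ?exprn_gt0.
have := metric_triangle (y s) (y (s ++ [:: i])) (y (s ++ i :: u)).
move: b0 b1; set p := _^-1; set q := (2 ^+ k)^-1; nra.
Qed.

(** Padding with zeros makes the index of a point as long as desired, which gives the point an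
    ancestor at every level. *)
Lemma strongly_regular_set_pad (s : seq 'I_l) (o : 'I_l) (m : nat) :
  strongly_regular_set k y -> o = 0%N :> nat -> y (s ++ nseq m o) = y s.
Proof.
move=> [_ y0] o0; elim: m s => [|m IH] s; first by rewrite cats0.
by rewrite /= -cat_rcons IH y0.
Qed.

Lemma lower_exponent_strongly_regular_set : (0 < k)%N -> (2 <= l)%N ->
  strongly_regular_set k y -> (forall x, exists s, y s = x) ->
  lower_exponent X (ln l%:R / (k%:R * ln 2)).
Proof.
move=> k0 l2 sreg surj; have [reg _] := sreg.
have l0 : (0 < l)%N by exact: ltnW.
pose o := Ordinal l0; pose b : R := 2 ^+ k.
pose beta : R := ln l%:R / (k%:R * ln 2).
have b2 : 2 <= b by rewrite -[leLHS]expr1 ler_eXn2l // ltr1n.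
have b1 : 1 < b by lra.
have b0 : 0 < b by lra.
have bn0 n : 0 < b ^+ n by rewrite exprn_gt0.
have beta0 : 0 <= beta.
  by rewrite divr_ge0 ?mulr_ge0 ?ln_ge0 ?ler1n.
have dball s u : mdist (y s) (y (s ++ u)) * b ^+ size s <= 1.
  by rewrite -ler_pdivlMr // div1r; exact: regular_set_mdist_le.
have diam2 : (diam [set: X] <= 2%:E)%E.
  apply: diam_le => // x z _ _; have [s <-] := surj x; have [t <-] := surj z.
  have := metric_triangle (y s) (y [::]) (y t).
  rewrite (metric_sym (y s) (y [::])).
  by have := dball [::] s; have := dball [::] t; rewrite /= expr0; lra.
(* The factor l^-2 pays for the two extra levels in (s/r)^beta <= b^((j+2) beta) = l^(j+2). *)
exists (l%:R ^+ 2)^-1; first by rewrite invr_gt0 exprn_gt0 // ltr0n.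
move=> r s r0 rs sdiam x; have s0 : 0 < s by lra.
have s2 : s <= 2 by rewrite -lee_fin; exact: le_trans diam2.
(* [n] is the least level with 2 b^-n <= s, and [j] the least number with s/r <= b^(j+2). *)
have [n [ns snb]] := exp_bracket b1 (divr_gt0 (ltr0Sn R 1) s0).
have [j [sj jsb]] := exp_bracket b1 (divr_gt0 (divr_gt0 s0 r0) (bn0 2)).
rewrite ler_pdivrMr // mulrC in ns.
(* For n = 0 the bound comes from s <= diam <= 2. *)
have {}snb : s * b ^+ n <= 2 * b.
  case: snb => [->|]; first by rewrite expr0; lra.
  by rewrite mulrA ltr_pdivlMr // => /ltW; lra.
rewrite ler_pdivrMr // -exprD in sj.
(* Minimality of [j] puts r below half the separation 4 b^-(n+j) of level n + j. For j = 0 a single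
   point is used and no separation is required. *)
have rj : j != 0%N -> r * b ^+ (n + j) < 2.
  case: jsb => [->//|] + _.
  have -> : b * (s / r / b ^+ 2) = s / r / b by field; rewrite !gt_eqF.
  rewrite ltr_pdivlMr // ltr_pdivlMr // => jr.
  rewrite exprD -(ltr_pM2r b0) (lt_le_trans _ snb) //.
  have -> : r * (b ^+ n * b ^+ j) * b = b ^+ j * b * r * b ^+ n by ring.
  by rewrite ltr_pM2r.
have [u ux] := surj x; pose v := u ++ nseq n o; pose w := take n v.
have vx : y v = x by rewrite /v strongly_regular_set_pad.
have sw : size w = n by rewrite size_takel // size_cat size_nseq leq_addl.
have wx : mdist (y w) x * b ^+ n <= 1.
  by have := dball w (drop n v); rewrite cat_take_drop vx sw.
have num : ((l ^ j)%:R%:E <= covering_number r (cball x s))%E.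
  rewrite -{1}[l]card_ord -card_tuple.
  apply: (@covering_number_separated _ _ _ _ _
    (fun t : j.-tuple 'I_l => y (w ++ t))).
    move=> t; rewrite /cball /= -(ler_pM2r (bn0 n)) (le_trans _ ns) //.
    have := dball w t; rewrite sw.
    have := metric_triangle x (y w) (y (w ++ t)).
    by rewrite (metric_sym x (y w)); have := bn0 n; move: wx; nra.
  move=> t t' tt'; have j0 : j != 0%N.
    apply: contraNneq tt' => j0; apply/eqP/val_inj => /=.
    have /size0nil -> : size t = 0%N by rewrite size_tuple.
    by have /size0nil -> : size t' = 0%N by rewrite size_tuple.
  rewrite -(ltr_pM2r (bn0 (n + j))) (lt_le_trans (rj j0)) //.
  have [_ /(_ (w ++ t) (w ++ t'))] := reg (n + j)%N.
  rewrite !size_cat sw !size_tuple => /(_ erefl erefl).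
  rewrite expz2Nmuln -/b ler_pdivrMl // mulrC -exprnP expr2 => sep.
  have /sep : w ++ t <> w ++ t'.
    by move/eqP; rewrite eqseq_cat // eqxx /= => /eqP/val_inj/eqP; apply/negP.
  by lra.
apply: le_trans num; rewrite lee_fin -/beta natrX.
rewrite mulrC ler_pdivrMr ?exprn_gt0 ?ltr0n // -exprD.
rewrite -(powR_ln_div R k0 l0) -powR_exprn // ge0_ler_powR ?nnegrE //.
by rewrite divr_ge0 // ltW.
Qed.

End regular_sets.

(** * Growing the tree *)

Lemma strongly_regular_set_of_branching (R : realType) (X : metricType R)
    (x0 : X) (k l : nat) : (2 <= k)%N ->
  (forall (n : nat) (x : X), exists p : 'I_l -> X,
    [/\ forall i : 'I_l, i = 0%N :> nat -> p i = x,
        forall i, mdist x (p i) <= (2 ^+ k ^+ n)^-1 / 2 &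
        forall i j, i != j -> 4 * (2 ^+ k ^+ n.+1)^-1 <= mdist (p i) (p j)]) ->
  exists y : seq 'I_l -> X, strongly_regular_set k y.
Proof.
move=> k2 branch.
have b4 : 4 <= 2 ^+ k :> R.
  have -> : 4 = 2 ^+ 2 :> R by rewrite expr2; lra.
  by rewrite ler_eXn2l // ltr1n.
have [f fP] := choice (fun q : nat * X => branch q.1 q.2).
(* The state carries the level and the current point; folding it from the root makes appending an
   entry one application of the choice [f]. *)
pose step (q : nat * X) i := (q.1.+1, f q i).
pose state s := foldl step (0%N, x0) s.
pose y s := (state s).2.
have stateE s : state s = (size s, y s).
  rewrite /y [LHS]surjective_pairing; congr (_, _).
  elim/last_ind: s => // s i IH; rewrite /state foldl_rcons size_rcons /=.
  by rewrite -[foldl _ _ _]/(state s) IH.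
have yr s i : y (rcons s i) = f (size s, y s) i.
  by rewrite -stateE /y /state foldl_rcons.
exists y; split; last first.
  by move=> s i i0; rewrite yr; have [-> //] := fP (size s, y s).
have near s i : mdist (y s) (y (rcons s i)) <= (2 ^+ k ^+ size s)^-1 / 2.
  by rewrite yr; have [_ + _] := fP (size s, y s); apply.
move=> n; split=> [s t sn|].
  case/lastP: t => // t i; rewrite size_rcons => -[tn].
  rewrite -cats1 => /prefixP[u]; rewrite cats1 => tsu.
  have -> : s = t.
    have := congr1 (take n) tsu.
    by rewrite -cats1 -{1}tn -{1}sn !take_size_cat.
  by rewrite expz2Nmuln exprN1 -tn; exact: near.
elim: n => [s t /size0nil -> /size0nil ->//|n IH].
move=> s t; case/lastP: s => // s i; case/lastP: t => // t j.
rewrite !size_rcons => -[sn] [tn] st.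
rewrite expz2Nmuln -exprnP expr2.
have [st'|st'] := eqVneq s t.
  have ij : i != j by apply: contra_not_neq st => ->; rewrite st'.
  rewrite -st' !yr; have [_ _ /(_ _ _ ij)] := fP (size s, y s).
  by rewrite sn; lra.
(* Distinct parents are 4 b^-n apart and each child moves by at most b^-n / 2. This leaves 3 b^-n,
   at least 4 b^-(n+1) because b >= 4. *)
have := IH s t sn tn (elimN eqP st'); rewrite expz2Nmuln -exprnP expr2.
have := near s i; have := near t j; rewrite sn tn.
have := metric_triangle (y s) (y (rcons s i)) (y t).
have := metric_triangle (y (rcons s i)) (y (rcons t j)) (y t).
rewrite (metric_sym (y (rcons t j)) (y t)) exprS invfM.
have p0 : 0 < (2 ^+ k ^+ n)^-1 :> R by rewrite invr_gt0 !exprn_gt0.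
have q4 : (2 ^+ k)^-1 <= 4^-1 :> R by rewrite lef_pV2 ?posrE ?exprn_gt0.
by move: p0 q4; set p := (_ ^+ n)^-1; set q := (2 ^+ k)^-1; nra.
Qed.

(** * Uniform branching from a lower exponent *)

Lemma lower_exponent_branching (R : realType) (X : metricType R)
    (alpha beta : R) (x0 x1 : X) : 0 <= alpha -> alpha < beta -> x0 <> x1 ->
  lower_exponent X beta ->
  exists k l : nat, [/\ (2 <= k)%N, (2 <= l)%N,
    alpha < ln l%:R / (k%:R * ln 2) &
    forall (n : nat) (x : X), exists p : 'I_l -> X,
    [/\ forall i : 'I_l, i = 0%N :> nat -> p i = x,
        forall i, mdist x (p i) <= (2 ^+ k ^+ n)^-1 / 2 &
        forall i j, i != j -> 4 * (2 ^+ k ^+ n.+1)^-1 <= mdist (p i) (p j)]].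
Proof.
move=> a0 ab x01 [C C0 CP].
(* As [D] is at most the diameter, every radius D b^-n is admissible in the lower exponent; as it is
   at most 1/2, that ball lies in the one of radius b^-n / 2. *)
pose D : R := Num.min (mdist x0 x1) (1 / 2).
have D0 : 0 < D by rewrite lt_min mdist_gt0 divr_gt0 // andbT; exact/eqP.
have D2 : D <= 1 / 2 by rewrite ge_min lexx orbT.
have Ddiam : (D%:E <= diam [set: X])%E.
  apply: le_trans (@le_diam _ _ [set: X] x0 x1 _ _) => //.
  by rewrite lee_fin ge_min lexx.
pose c := C * (D / 8) `^ beta.
have c0 : 0 < c by rewrite mulr_gt0 // powR_gt0 // divr_gt0.
have gt1_powR (e : R) : 0 < e -> 1 < 2 `^ e.
  by move=> e0; rewrite /powR pnatr_eq0 /= expR_gt1 mulr_gt0 // ln_gt0 // ltr1n.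
have ba0 : 0 < beta - alpha by rewrite subr_gt0.
have [K1 HK1] := exp_unbounded (2 / c) (gt1_powR _ ba0).
have [K2 HK2] := exp_unbounded (8 / D) (ltr1n R 2).
(* The first bound gives c b^beta > 2 b^alpha; the second puts the covering scale 8 b^-(n+1) below
   the radius D b^-n. *)
have [k [k2 Hc Hb]] : exists k, [/\ (2 <= k)%N,
    2 / c < (2 `^ (beta - alpha)) ^+ k & 8 / D < 2 ^+ k].
  exists (maxn 2 (maxn K1 K2)).
  by rewrite HK1 ?HK2 // !leq_max leqnn ?orbT.
exists k.
pose b : R := 2 ^+ k; rewrite -/b in Hb *.
have b0 : 0 < b by rewrite exprn_gt0.
pose N := C * (D * b / 8) `^ beta.
have NE : N = c * b `^ beta.
  by rewrite /N [D * b / 8]mulrAC (@powRM _ (D / 8)) ?mulrA // ltW // divr_gt0.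
have bE e : b `^ e = (2 `^ e) ^+ k by rewrite powR_exprn.
have Na : 2 * b `^ alpha < N.
  rewrite NE; have -> : beta = (beta - alpha) + alpha by rewrite subrK.
  rewrite powRD; last by apply/implyP => _; rewrite gt_eqF.
  rewrite mulrA ltr_pM2r ?powR_gt0 // bE.
  by rewrite mulrC -ltr_pdivrMr.
have ba1 : 1 <= b `^ alpha.
  by rewrite -(powRr0 b) ler_powR // exprn_ege1 // ler1n.
(* Truncation loses less than 1 <= b^alpha, so N > 2 b^alpha still yields l > b^alpha. *)
pose l := Num.truncn N; exists l.
have N0 : 0 <= N by lra.
have /andP[lN Nl] := truncn_itv N0; rewrite -/l in lN Nl.
have la : b `^ alpha < l%:R by move: Nl; rewrite -natr1; lra.
have l1 : (1 < l)%N by rewrite -(ltr1n R); lra.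
split => //.
  have ln2 : 0 < ln 2 :> R by rewrite ln_gt0 // ltr1n.
  have k0 : 0 < k%:R :> R by rewrite ltr0n ltnW.
  rewrite ltr_pdivlMr ?mulr_gt0 //.
  have -> : alpha * (k%:R * ln 2) = ln (b `^ alpha).
    by rewrite ln_powR lnXn // mulr_natl.
  by rewrite ltr_ln ?posrE ?powR_gt0 // ltr0n ltnW.
move=> n x; set p := (b ^+ n)^-1.
have p0 : 0 < p by rewrite invr_gt0 exprn_gt0.
have p1 : p <= 1 by rewrite invf_le1 ?exprn_gt0 // !exprn_ege1 // ler1n.
have bDp : 2 * (4 * (b ^+ n.+1)^-1) < D * p.
  rewrite exprS invfM -/p mulrA mulrA ltr_pM2r // ltr_pdivrMr //.
  by move: Hb; rewrite ltr_pdivrMr //; lra.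
have r0 : 0 < 4 * (b ^+ n.+1)^-1 by rewrite mulr_gt0 // invr_gt0 exprn_gt0.
have [||q [q0 qx qsep]] := @separated_of_covering_number R X
    (cball x (p / 2)) (4 * (b ^+ n.+1)^-1) l x (ltW r0).
- by rewrite /cball /= mdistxx divr_ge0 // ltW.
- apply: (@le_trans _ _ (N%:E)); first by rewrite lee_fin.
  apply: le_trans
    (covering_number_subset _ (_ : cball x (D * p) `<=` _)); last first.
    by move=> z /=/le_trans; apply; rewrite [leRHS]mulrC ler_pM2r //; lra.
  have := CP (2 * (4 * (b ^+ n.+1)^-1)) (D * p) _ bDp.
  have -> : D * p / (2 * (4 * (b ^+ n.+1)^-1)) = D * b / 8.
    rewrite /p exprS; field.
    by rewrite !gt_eqF ?exprn_gt0.
  apply; first by rewrite mulr_gt0.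
  by apply: le_trans Ddiam; rewrite lee_fin ler_piMr // ltW.
by exists q; split.
Qed.

(** * The equivalence, through subsets of X *)

Theorem theorem3p1 (R : realType) (X : metricType R) (alpha : R)
    (alpha_ge0 : 0 <= alpha) :
  (alpha%:E < modified_lower_dim X)%E <->
  exists k l : nat,
    [/\ (2 <= k)%N, (2 <= l)%N, alpha < ln l%:R / (k%:R * ln 2) &
        exists y : seq 'I_l -> X, strongly_regular_set k y].
Proof.
split.
  move=> /ereal_sup_gt[_ [E _ <-]]; rewrite /lower_dim.
  case: asboolP => [[x0 [x1 x01]]|_]; last by rewrite lte_fin ltNge alpha_ge0.
  move=> /ereal_sup_gt[_ [beta Ebeta <-]]; rewrite lte_fin => ab.
  have [k [l [k2 l2 akl branch]]] :=
    lower_exponent_branching alpha_ge0 ab x01 Ebeta.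
  have [y yreg] := strongly_regular_set_of_branching x0 k2 branch.
  (* Distances in [E] are those of [X], so the inclusion preserves regularity. *)
  exists k, l; split => //; exists (set_val \o y).
  by case: yreg => yreg y0; split => // s i i0 /=; rewrite y0.
move=> [k [l [k2 l2 akl [y yreg]]]].
have mem_range s : y s \in range y by rewrite inE; exists s.
pose z s : set_type (range y) := SigSub (mem_range s).
have zreg : strongly_regular_set k z.
  by case: yreg => yreg y0; split => // s i i0; apply: val_inj; exact: y0.
have zsurj x : exists s, z s = x.
  by have [s _ yx] := set_valP x; exists s; exact: val_inj.
have k0 : (0 < k)%N by exact: ltnW.
have zexp := lower_exponent_strongly_regular_set k0 l2 zreg zsurj.
rewrite (@lt_le_trans _ _ (ln l%:R / (k%:R * ln 2))%:E) // ?lte_fin //.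
apply: (@le_trans _ _ (lower_dim (set_type (range y)))); last first.
  by apply: ereal_sup_ubound; exists (range y).
rewrite /lower_dim asboolT; first exact/ereal_sup_ubound/imageP.
(* Two nodes of level 1 lie at positive distance, so the range escapes the one-point convention. *)
pose i0 := Ordinal (ltnW l2); pose i1 := Ordinal l2.
exists (z [:: i0]), (z [:: i1]) => z01.
have [_ /(_ [:: i0] [:: i1] erefl erefl)] := zreg.1 1%N.
rewrite z01 mdistxx expz2Nmuln leNgt => /(_ _)/negP; apply => //.
Qed.
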